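(* Let $(X,d)$ be a compact metric space and let $\phi$ be a continuous flow on $X$ without fixed points. Every stable class of $\phi$ has zero measure with respect to any ergodic $\phi$-invariant Borel probability measure with positive entropy. In particular, if $\phi$ has an ergodic invariant Borel probability measure with positive entropy, then $\phi$ has uncountably many stable classes.
   Context: A continuous flow on $X$ is a continuous map $\phi:\mathbb{R}\times X\to X$ with $\phi(0,x)=x$ and $\phi(t+s,x)=\phi(s,\phi(t,x))$; write $\phi_t=\phi(t,\cdot)$. A point $x$ is fixed if $\phi_t(x)=x$ for all $t$. A $\phi$-invariant measure is one that is $\phi_t$-invariant for every $t\in\mathbb{R}$; it is ergodic if $\mu(A)\mu(A^c)=0$ for every $\phi$-invariant measurable $A$. The entropy of a $\phi$-invariant $\mu$ is $h_\mu(\phi)=h_\mu(\phi_1)$, the measure-theoretic entropy of the time-one map. Let $Rep$ be the set of increasing homeomorphisms $h:\mathbb{R}\to\mathbb{R}$ with $h(0)=0$. The strong stable set of $x\in X$ is $$W^{ss}(x)=\{y\in X:\ \exists h\in Rep\text{ s.t. }\lim_{t\to\infty}d(\phi_t(x),\phi_{h(t)}(y))=0\},$$ and the stable set of $x$ is $W^s(x)=\bigcup_{t\in\mathbb{R}}W^{ss}(\phi_t(x))$. A set $A\subseteq X$ is a stable class of $\phi$ if $A=W^s(x)$ for some $x\in X$. For a not necessarily Borel set $A\subseteq X$, $\mu(A)=0$ means $\mu(B)=0$ for every Borel set $B\subseteq A$. *)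

(* Defs.v *)
From HB Require Import structures.
From mathcomp Require Import all_boot all_order all_algebra.
From mathcomp Require Import all_classical all_reals all_analysis.

Set Implicit Arguments.
Unset Strict Implicit.
Unset Printing Implicit Defensive.

Import Order.TTheory GRing.Theory Num.Theory.
Import numFieldNormedType.Exports.

Local Open Scope classical_set_scope.
Local Open Scope ring_scope.

(* The base point is only there because the library's measurable types are
   pointed: a pointedMetricType is a nonempty metric space. *)
#[short(type="pointedMetricType")]
HB.structure Definition PointedMetric (K : numDomainType) :=
  {M of Metric K M & Pointed M}.

Notation borelType X := (g_sigma_algebraType (@open X)).

Section Flow.
Context {R : realType} {X : pointedMetricType R}.
Implicit Types (phi : R -> X -> X) (x : X).

Definition continuous_flow phi :=
  [/\ continuous (fun p : R * X => phi p.1 p.2),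
      forall x, phi 0 x = x
    & forall t s x, phi (t + s) x = phi s (phi t x)].

Definition fixed_point phi x := forall t, phi t x = x.

Definition Rep : set (R -> R) := [set h : R -> R |
  [/\ {homo h : s t / s < t}, h 0 = 0, continuous h
    & exists k : R -> R, [/\ cancel h k, cancel k h & continuous k]]].

Definition Wss phi x : set X := [set y | exists2 h, Rep h &
  mdist (phi t x) (phi (h t) y) @[t --> +oo] --> (0 : R)].

Definition Ws phi x : set X := \bigcup_(t in [set: R]) Wss phi (phi t x).

Definition stable_class phi (A : set X) := exists x, A = Ws phi x.

Definition flow_invariant phi (mu : probability (borelType X) R) :=
  forall t (A : set (borelType X)), measurable A ->
    mu (phi t @^-1` A) = mu A.

Definition flow_ergodic phi (mu : probability (borelType X) R) :=
  flow_invariant phi mu /\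
  forall A : set (borelType X), measurable A ->
    (forall t, phi t @` A = A) -> (mu A * mu (~` A) = 0)%E.

End Flow.

Section KolmogorovSinai.
Context d {T : measurableType d} {R : realType}.
Variables (mu : probability T R) (f : T -> T).

Definition measurable_partition k (P : 'I_k -> set T) :=
  partition [set: 'I_k] P [set: T] /\ forall i, measurable (P i).

(* Cells of measure 0, in particular empty ones, contribute 0. *)
Definition shannon_entropy (I : finType) (P : I -> set T) : R :=
  - \sum_(i : I) fine (mu (P i)) * ln (fine (mu (P i))).

(* The cells of P \/ f^-1 P \/ ... \/ f^-(n-1) P; some may be empty. *)
Definition refined_cell k (P : 'I_k -> set T) n (w : {ffun 'I_n -> 'I_k}) :
  set T := \bigcap_(i in [set: 'I_n]) (iter i f @^-1` P (w i)).

(* By subadditivity the limit exists when mu is f-invariant. *)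
Definition partition_entropy k (P : 'I_k -> set T) : R :=
  limn (fun n => shannon_entropy (@refined_cell k P n) / n%:R).

Definition measure_entropy : \bar R :=
  ereal_sup [set e | exists k (P : 'I_k -> set T),
    measurable_partition P /\ e = (partition_entropy P)%:E].

End KolmogorovSinai.

Definition flow_entropy {R : realType} {X : pointedMetricType R}
    (phi : R -> X -> X) (mu : probability (borelType X) R) : \bar R :=
  measure_entropy mu (phi 1 : borelType X -> borelType X).

(* Main.v *)
Require Import Defs.
From HB Require Import structures.
From mathcomp Require Import all_boot all_order all_algebra.
From mathcomp Require Import all_classical all_reals all_analysis.
From mathcomp Require Import measurable_realfun zify ring lra.

Set Implicit Arguments.
Unset Strict Implicit.
Unset Printing Implicit Defensive.

Import Order.TTheory GRing.Theory Num.Theory.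
Import numFieldNormedType.Exports.

Local Open Scope classical_set_scope.
Local Open Scope ring_scope.

(** The idea is that an orbit in the stable class of [x] is, up to a slowly
    varying clock, the orbit of [x] itself, so that a stable class carries
    almost no information; positive entropy forbids an ergodic measure to live
    on such a set.

    Let [y] be in the stable class of [x].  From some time on, the orbit of [y]
    stays [d]-close to a reparametrised orbit of some [phi m x]: there is a
    continuous clock [u] with [u 0 = 0] such that [phi (u s) (phi m x)] is
    [d]-close to [phi s z] for all [s >= 0], where [z] is on the orbit of [y]
    ([Ws_follows]).  Since there are no fixed points, some arbitrarily small
    time [t] is a period of no point ([small_aperiodic_time]), hence [phi t]
    moves all points by at least some [c > 0].  If [d] is small, the error
    [u (a + b) - u a - b] over a time [b <= L] can therefore never equal [t] or
    [- t], and by the intermediate value theorem it stays below [t]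
    ([follows_near_isometry]).  So, up to [2 t], the clock is determined by one
    letter of a three letter alphabet per block of length [L]
    ([drift_coding]), and the orbit segments of length [n] of all such [z] are
    shadowed by about [3 ^ (n / L)] reference segments, an exponential growth
    of rate [ln 3 / L], as small as desired ([shadowed_tube]).

    The closure of the set of these [z] is compact, and its saturation by the
    flow is a countable union of compact tubes, hence an invariant Borel set,
    of measure 0 or 1 by ergodicity.  If it has measure 1, compact tubes of
    measure close to 1 inherit the small growth rate.  When this is possible
    at all scales the entropy vanishes ([entropy_eq0_of_shadowing]): the
    itinerary of a point of the tube is described by the index of a reference
    segment and the corrections needed at the few times when the point is near
    the boundary between cells, and Gibbs' inequality turns this description
    length into a bound of the Shannon entropy ([entropy_le_names]).

    Hence a stable class is contained in a Borel set of measure 0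
    ([Ws_negligible]).  This is stronger than having no Borel subset of
    positive measure, and, unlike that property, it passes to countable unions
    of arbitrary sets; since stable classes cover [X], there are uncountably
    many of them. *)

(** * Gibbs' inequality and step functions *)

Section Gibbs.
Context {R : realType}.

(** [- ln (q i)] is the length of an ideal code, so any choice of
    subprobability weights [q] bounds the entropy of [p] by the mean code
    length.  It suffices to use [ln v <= v - 1] at [v = q i / p i]. *)
Lemma gibbs_inequality (I : finType) (p q : I -> R) :
  (forall i, 0 <= p i) -> (forall i, 0 < q i) -> \sum_i q i <= \sum_i p i ->
  - (\sum_i p i * ln (p i)) <= \sum_i p i * - ln (q i).
Proof.
move=> p0 q0 qp.
have key i : - (p i * ln (p i)) - p i * - ln (q i) <= q i - p i.
  have [pi0|pi0] := eqVneq (p i) 0; first by rewrite pi0; have := q0 i; lra.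
  have pi1 : 0 < p i by rewrite lt_neqAle eq_sym pi0 p0.
  have := @le_ln1Dx R (q i / p i - 1).
  rewrite addrCA subrr addr0 ln_div ?posrE//.
  have -> : -1 < q i / p i - 1 by rewrite ltrBDr addNr divr_gt0.
  move=> /(_ isT) h.
  have -> : - (p i * ln (p i)) - p i * - ln (q i) = p i * (ln (q i) - ln (p i)).
    by ring.
  have -> : q i - p i = p i * (q i / p i - 1) by field.
  by rewrite ler_pM2l.
rewrite -subr_le0 -sumrN -sumrB.
by apply: le_trans (ler_sum _ (fun i _ => key i)) _; rewrite sumrB subr_le0.
Qed.

Lemma ln_prod (I : finType) (F : I -> R) : (forall i, 0 < F i) ->
  ln (\prod_i F i) = \sum_i ln (F i).
Proof.
move=> F0.
suff [] : 0 < \prod_i F i /\ ln (\prod_i F i) = \sum_i ln (F i) by [].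
elim/big_rec2 : _ => [|i x y _ [y0 <-]]; first by rewrite ln1.
by rewrite lnM ?posrE ?mulr_gt0.
Qed.

End Gibbs.

Section MeasureSums.
Context d {T : measurableType d} {R : realType} (mu : probability T R).

(** Integration of an inequality between two step functions; it turns the
    pointwise estimate of a code length into an estimate of its mean without
    identifying the level sets. *)
Lemma sum_measure_le (I J : finType) (A : I -> set T) (B : J -> set T)
    (a : I -> R) (b : J -> R) :
  (forall i, measurable (A i)) -> (forall j, measurable (B j)) ->
  (forall i, 0 <= a i) -> (forall j, 0 <= b j) ->
  (forall y, \sum_i a i * \1_(A i) y <= \sum_j b j * \1_(B j) y) ->
  \sum_i a i * fine (mu (A i)) <= \sum_j b j * fine (mu (B j)).
Proof.
have integral_sum (K : finType) (C : K -> set T) (c : K -> R) :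
    (forall i, measurable (C i)) -> (forall i, 0 <= c i) ->
    (\int[mu]_x (\sum_i c i * \1_(C i) x)%:E =
     (\sum_i c i * fine (mu (C i)))%:E)%E.
  move=> mC c0.
  under eq_integral do rewrite -sumEFin.
  rewrite ge0_integral_sum//; last 2 first.
  - move=> i; apply/measurable_EFinP; apply: measurable_funM => //.
  - by move=> i x _; rewrite lee_fin mulr_ge0.
  rewrite -sumEFin; apply: eq_bigr => i _.
  rewrite (integralZl_indic _ (fun=> C i))//; last first.
    by move=> ci0; have := c0 i; rewrite leNgt ci0.
  rewrite integral_indic// setIT EFinM fineK//.
  exact: fin_num_measure.
move=> mA mB a0 b0 le_AB; rewrite -lee_fin -!integral_sum//.
apply: ge0_le_integral => //.
- by move=> x _; rewrite lee_fin sumr_ge0// => i _; rewrite mulr_ge0.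
- apply/measurable_EFinP; apply: measurable_sum => i.
  exact: measurable_funM.
- apply/measurable_EFinP; apply: measurable_sum => i.
  exact: measurable_funM.
- by move=> x _; rewrite lee_fin; exact: le_AB.
Qed.

End MeasureSums.

(** * Entropy of itineraries that follow few names *)

Section RefinedPartition.
Context d {T : measurableType d} {R : realType}.
Context (mu : probability T R) (f : T -> T) (mf : measurable_fun setT f).
Context k (P : 'I_k -> set T) (partP : measurable_partition P).

Lemma measurable_iter j : measurable_fun setT (iter j f).
Proof.
elim: j => [|j ih] /=; first exact: measurable_id.
by apply: (measurableT_comp mf ih).
Qed.

Lemma measurable_preimage_iter j (A : set T) : measurable A ->
  measurable (iter j f @^-1` A).
Proof.
by move=> mA; rewrite -[X in measurable X]setTI; exact: measurable_iter.
Qed.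

Lemma measurable_refined_cell n w : measurable (refined_cell f P (n := n) w).
Proof.
apply: fin_bigcap_measurable => // i _; apply: measurable_preimage_iter.
by have [_] := partP; apply.
Qed.

Lemma partition_coverE y : exists i, P i y.
Proof.
have [[cov _ _] _] := partP.
have : [set: T] y by [].
by rewrite -cov => -[i _ Piy]; exists i.
Qed.

Lemma partition_uniq i j y : P i y -> P j y -> i = j.
Proof.
have [[_ triv _] _] := partP.
by move=> Pi Pj; apply: triv => //; exists y.
Qed.

Lemma sum_refined_cell n y :
  \sum_w (\1_(refined_cell f P (n := n) w) y : R) = 1.
Proof.
have /choice[lab labP] : forall j : 'I_n, exists i, P i (iter j f y).
  by move=> j; exact: partition_coverE.
rewrite (bigD1 [ffun j => lab j])//= indicE mem_set; last first.
  by move=> j _ /=; rewrite ffunE.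
rewrite big1 ?addr0// => w neq_w; rewrite indicE memNset// => cell_w.
move/eqP: neq_w; apply; apply/ffunP => j; rewrite ffunE.
exact: partition_uniq (cell_w j I) (labP j).
Qed.

Lemma sum_measure_refined_cell n :
  1 <= \sum_w fine (mu (refined_cell f P (n := n) w)).
Proof.
pose mu_cell w := fine (mu (refined_cell f P (n := n) w)).
rewrite -(eq_bigr _ (fun w _ => mul1r (mu_cell w))).
have := @sum_measure_le _ _ _ mu 'I_1 {ffun 'I_n -> 'I_k} (fun=> setT)
  (refined_cell f P (n := n)) (fun=> 1) (fun=> 1).
rewrite big_ord1 mul1r probability_setT/=.
apply => // [w|y]; first exact: measurable_refined_cell.
rewrite big_ord1 mul1r indicT/=.
by under eq_bigr do rewrite mul1r; rewrite sum_refined_cell.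
Qed.

End RefinedPartition.

Section NameEntropy.
Context d {T : measurableType d} {R : realType}.
Context (mu : probability T R) (f : T -> T) (mf : measurable_fun setT f).
Context (invf : forall A, measurable A -> mu (f @^-1` A) = mu A).
Context k (P : 'I_k -> set T) (partP : measurable_partition P).

Lemma measure_preimage_iter j (A : set T) : measurable A ->
  mu (iter j f @^-1` A) = mu A.
Proof.
move=> mA; elim: j => // j ih.
have -> : iter j.+1 f @^-1` A = f @^-1` (iter j f @^-1` A).
  by apply/funext => y; rewrite /preimage/= -iterSr.
by rewrite invf ?ih//; exact: measurable_preimage_iter.
Qed.

(** The word [w] is coded by choosing one of the names uniformly and then, at
    each time, either confirming its letter (probability [1 - c]) or replacing
    it by an arbitrary letter (probability [c / k] each).  On the cell of [y]
    a code word costs [ln #|J|], plus [- ln (1 - c)] per letter, plus at most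
    [ln (k / c)] per correction.  Corrections occur only at visits to [U] when
    [y] is in [K], and number at most [n] otherwise; by invariance their mean
    number is at most [n * (mu U + mu (~` K))]. *)
Lemma entropy_le_names (J : finType) n (name : J -> 'I_n -> 'I_k)
    (U K : set T) (c : R) :
  (0 < #|J|)%N -> 0 < c < 1 -> measurable U -> measurable K ->
  (forall y, K y -> exists i, forall j : 'I_n,
     ~ U (iter j f y) -> P (name i j) (iter j f y)) ->
  shannon_entropy mu (refined_cell f P (n := n)) <=
  ln #|J|%:R + n%:R * (- ln (1 - c) +
    ln (k%:R / c) * (fine (mu U) + fine (mu (~` K)))).
Proof.
move=> J0 /andP[c0 c1] mU mK nameP.
have k0 : (0 < k)%N.
  have [i _] := partition_coverE partP point.
  exact: leq_ltn_trans (leq0n i) (ltn_ord i).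
have k0R : 0 < k%:R :> R by rewrite ltr0n.
have J0R : 0 < #|J|%:R :> R by rewrite ltr0n.
set a := - ln (1 - c); set b := ln (k%:R / c).
have a0 : 0 <= a by rewrite oppr_ge0 ln_le0//; lra.
have b0 : 0 <= b.
  rewrite ln_ge0// ler_pdivlMr// mul1r (le_trans (ltW c1))//.
  by rewrite ler1n.
pose kappa (u v : 'I_k) : R := if u == v then 1 - c else c / k%:R.
have kappa0 u v : 0 < kappa u v.
  by rewrite /kappa; case: ifP => _; [lra|exact: divr_gt0].
have kappa_ln u v : - ln (kappa u v) <= a + b * (u != v)%:R.
  rewrite /kappa; case: eqP => _ /=; first by rewrite mulr0 addr0.
  by rewrite mulr1 -[c / _]invf_div lnV ?posrE ?divr_gt0// opprK lerDr.
have kappa_sum v : \sum_u kappa u v <= 1.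
  rewrite (bigD1 v)//= {1}/kappa eqxx.
  rewrite (eq_bigr (fun=> c / k%:R)); last first.
    by move=> u /negPf uv; rewrite /kappa uv.
  rewrite sumr_const cardC1 card_ord -lerBrDl opprB addrCA subrr addr0.
  rewrite -[leLHS]mulr_natl mulrCA ler_piMr ?(ltW c0)//.
  by rewrite ler_pdivrMr// mul1r ler_nat leq_pred.
pose prod_i (i : J) (w : {ffun 'I_n -> 'I_k}) : R :=
  \prod_j kappa (w j) (name i j).
have prod_i0 i w : 0 < prod_i i w by rewrite prodr_gt0.
pose q w := #|J|%:R^-1 * \sum_i prod_i i w.
have q_ge i w : #|J|%:R^-1 * prod_i i w <= q w.
  rewrite ler_pM2l ?invr_gt0// (bigD1 i)//= lerDl sumr_ge0// => i' _.
  exact: ltW.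
have [i0 _] : exists i0 : J, true by move/card_gt0P : J0 => [i0 _]; exists i0.
have q0 w : 0 < q w.
  by apply: lt_le_trans (q_ge i0 w); rewrite mulr_gt0 ?invr_gt0.
have q_sum : \sum_w q w <= 1.
  rewrite -mulr_sumr exchange_big/= mulrC ler_pdivrMr// mul1r.
  rewrite -sum1_card natr_sum; apply: ler_sum => i _.
  rewrite -(bigA_distr_bigA (fun j u => kappa u (name i j))).
  rewrite prodr_ile1// => j _; rewrite kappa_sum sumr_ge0// => u _.
  exact: ltW.
have q_ln i w : - ln (q w) <=
    ln #|J|%:R + \sum_j (a + b * (w j != name i j)%:R).
  apply: le_trans (_ : - ln (#|J|%:R^-1 * prod_i i w) <= _).
    by rewrite lerN2 ler_ln ?posrE ?q0 ?q_ge// mulr_gt0 ?invr_gt0.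
  rewrite lnM ?posrE ?invr_gt0// lnV ?posrE// opprD opprK lerD2l.
  by rewrite ln_prod// -sumrN ler_sum.
have q1 w : 0 <= - ln (q w).
  rewrite oppr_ge0 ln_le0//; apply: le_trans q_sum.
  by rewrite (bigD1 w)//= lerDl sumr_ge0// => i _; exact: ltW.
apply: le_trans (_ : \sum_w fine (mu (refined_cell f P w)) * - ln (q w) <= _).
  apply: gibbs_inequality => //; last first.
    exact: le_trans q_sum (sum_measure_refined_cell _ mf partP _).
  by move=> w; rewrite fine_ge0.
pose B (s : 'I_1 + ('I_n + 'I_1)) : set T := match s with
  | inl _ => setT | inr (inl j) => iter j f @^-1` U | inr (inr _) => ~` K end.
pose bb (s : 'I_1 + ('I_n + 'I_1)) : R := match s with
  | inl _ => ln #|J|%:R + n%:R * a | inr (inl j) => b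
  | inr (inr _) => n%:R * b end.
have sumB (F : set T -> R) : \sum_s bb s * F (B s) =
    (ln #|J|%:R + n%:R * a) * F setT +
    (\sum_(j < n) b * F (iter j f @^-1` U) + n%:R * b * F (~` K)).
  rewrite !big_sumType/= /B/= /bb/=.
  by rewrite !big_ord1.
under eq_bigr do rewrite mulrC.
apply: le_trans (@sum_measure_le _ _ _ mu _ _ (refined_cell f P (n := n)) B
  (fun w => - ln (q w)) bb _ _ _ _ _) _ => //.
- by move=> w; exact: measurable_refined_cell.
- move=> [_|[j|_]] //=; last exact: measurableC.
  exact: measurable_preimage_iter.
- have lnJ0 : 0 <= ln #|J|%:R :> R by rewrite ln_ge0// ler1n.
  by move=> [_|[j|_]] //=; rewrite ?addr_ge0 ?mulr_ge0.
- move=> y; rewrite (sumB (fun A => \1_A y)) indicT mulr1.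
  have [lab labP] : exists w, refined_cell f P (n := n) w y.
    have /choice[lab labP] : forall j : 'I_n, exists i, P i (iter j f y).
      by move=> j; exact: (partition_coverE partP).
    by exists [ffun j => lab j] => j _ /=; rewrite ffunE.
  rewrite (bigD1 lab)//= indicE mem_set// mulr1 big1 ?addr0; last first.
    move=> w neq_w; rewrite indicE memNset ?mulr0// => cell_w.
    move/eqP: neq_w; apply; apply/ffunP => j.
    exact: (partition_uniq partP) (cell_w j I) (labP j I).
  have [Ky|nKy] := pselect (K y).
    have [i iP] := nameP y Ky.
    apply: le_trans (q_ln i lab) _; rewrite -addrA lerD2l.
    rewrite big_split/= sumr_const card_ord mulr_natl lerD2l.
    rewrite ler_wpDr ?mulr_ge0//; apply: ler_sum => j _.
    rewrite ler_wpM2l// indicE.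
    have [Uy|nUy] := pselect (U (iter j f y)).
      by rewrite mem_set//= lern1 leq_b1.
    rewrite (_ : lab j = name i j) ?eqxx//.
    exact: (partition_uniq partP) (labP j I) (iP j nUy).
  apply: le_trans (q_ln i0 lab) _; rewrite -addrA lerD2l.
  rewrite big_split/= sumr_const card_ord mulr_natl lerD2l.
  rewrite [X in _ + X](_ : _ = n%:R * b); last by rewrite indicE mem_set ?mulr1.
  rewrite ler_wpDl//; first by rewrite sumr_ge0// => j _; rewrite mulr_ge0.
  rewrite -[X in X%:R * b](card_ord n) -sum1_card natr_sum mulr_suml.
  by apply: ler_sum => j _; rewrite mul1r ler_piMr// lern1 leq_b1.
rewrite (sumB (fun A => fine (mu A))) probability_setT/= mulr1.
rewrite (eq_bigr (fun=> b * fine (mu U))); last first.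
  by move=> j _; rewrite measure_preimage_iter.
rewrite sumr_const card_ord -mulr_natl le_eqVlt; apply/orP; left; apply/eqP.
by ring.
Qed.

End NameEntropy.

(** * Regularity of Borel probability measures on a metric space *)

Section MetricTopology.
Context {R : realType} {X : metricType R}.

Lemma ler_dist_mdist (x y x' y' : X) :
  `|mdist x y - mdist x' y'| <= mdist x x' + mdist y y'.
Proof.
have h1 := metric_triangle x x' y; have h2 := metric_triangle x' y' y.
have h3 := metric_triangle x' x y'; have h4 := metric_triangle x y y'.
rewrite (metric_sym x' x) in h3; rewrite (metric_sym y' y) in h2.
by rewrite ler_norml; apply/andP; split; lra.
Qed.

Lemma cvg_mdist (T : Type) (F : set_system T) (FF : Filter F) (f g : T -> X)
    (x y : X) :
  f @ F --> x -> g @ F --> y -> mdist (f t) (g t) @[t --> F] --> mdist x y.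
Proof.
move=> fx gy; apply/cvgrPdist_lt => e e0.
have e20 : 0 < e / 2 by rewrite divr_gt0.
have nf := metricType_numDomainType.cvgr_dist_lt fx e20.
have ng := metricType_numDomainType.cvgr_dist_lt gy e20.
near=> t; apply: le_lt_trans (ler_dist_mdist _ _ _ _) _; rewrite (splitr e).
by apply: ltrD; [near: t; exact: nf|near: t; exact: ng].
Unshelve. all: by end_near. Qed.

Lemma continuous_mdist : continuous (fun p : X * X => mdist p.1 p.2).
Proof. by move=> p; apply: cvg_mdist; [exact: cvg_fst|exact: cvg_snd]. Qed.

Lemma closed_mdist_le (T : topologicalType) (f g : T -> X) e :
  continuous f -> continuous g -> closed [set t | mdist (f t) (g t) <= e].
Proof.
move=> cf cg.
apply: (closed_comp (f := fun t => mdist (f t) (g t)) (D := [set r | r <= e])).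
  by move=> t _; apply: cvg_mdist; [exact: cf|exact: cg].
exact: closed_le.
Qed.

Lemma closed_mdist_ge (x : X) e : closed [set y | e <= mdist x y].
Proof.
apply: (closed_comp (f := fun y => mdist x y) (D := [set r | e <= r])).
  by move=> t _; apply: cvg_mdist; [exact: cvg_cst|exact: cvg_id].
exact: closed_ge.
Qed.

(** Stated for all small [e] so that finitely many pairs can share a gap.
    The distance is positive and continuous on the compact [C `*` D]. *)
Lemma disjoint_compact_gap (C D : set X) : compact C -> compact D ->
  C `&` D = set0 ->
  \forall e \near 0^'+, forall x y, C x -> D y -> e < mdist x y.
Proof.
move=> cptC cptD CD0.
have := compact_setX cptC cptD => /compact_near_coveringP.
move=> /(_ R (at_right 0) (fun e p => e < mdist p.1 p.2)) near_gap.
apply: filterS (near_gap _ _) => [e gap x y Cx Dy|[x y] [/= Cx Dy]].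
  exact: (gap (x, y)).
have dxy : 0 < mdist x y.
  rewrite mdist_gt0; apply/eqP => xy.
  have : (C `&` D) x by split=> //; rewrite xy.
  by rewrite CD0.
have nb : nbhs (mdist x y) [set r | mdist x y / 2 < r].
  by apply: lt_nbhsr; rewrite /= ltr_pdivrMr// ltr_pMr// ltr1n.
have {}nb := @continuous_mdist (x, y) _ nb.
near=> p e => /=.
apply: (@lt_trans _ _ (mdist x y / 2)); last by near: p; exact: nb.
by near: e; apply: nbhs_right_lt; rewrite divr_gt0.
Unshelve. all: by end_near. Qed.

End MetricTopology.

Section Regularity.
Context {R : realType} {X : pointedMetricType R}.
Implicit Types (A : set (borelType X)) (mu : probability (borelType X) R).

Lemma borel_open (A : set X) : open A -> measurable (A : set (borelType X)).
Proof. by move=> oA; exact: sub_sigma_algebra. Qed.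

Lemma borel_closed (A : set X) : closed A -> measurable (A : set (borelType X)).
Proof.
move=> cA; rewrite -(setCK A); apply: measurableC.
by apply: borel_open; exact: closed_openC.
Qed.

Lemma nonincreasing_measure_lt mu (F : (set (borelType X))^nat) (e : \bar R) :
  (forall n, measurable (F n)) -> nonincreasing_seq F ->
  (mu (\bigcap_n F n) < e)%E -> exists n, (mu (F n) < e)%E.
Proof.
move=> mF niF lt_e.
have mF' : measurable (\bigcap_n F n) by exact: bigcapT_measurable.
have cvF : mu \o F @ \oo --> mu (\bigcap_n F n).
  apply: nonincreasing_cvg_mu => //.
  by rewrite -ge0_fin_numE// fin_num_measure.
have : \forall n \near \oo, (mu (F n) < e)%E.
  by apply: (cvF [set y | (y < e)%E]); exact: open_ereal_lt'.
by case=> N _ /(_ N (leqnn N)); exists N.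
Qed.

(** The closed sets are the points at distance at least [1 / (n + 1)] from the
    complement. *)
Lemma open_closed_exhaustion (O : set X) : open O ->
  exists2 C : (set X)^nat, (forall n, closed (C n)) /\ nondecreasing_seq C &
    O = \bigcup_n C n.
Proof.
move=> oO; exists (fun n =>
  \bigcap_(x in ~` O) [set y | n.+1%:R^-1 <= mdist x y]).
  split=> [n|m n mn].
    by apply: closed_bigI => x _; exact: closed_mdist_ge.
  apply/subsetPset => y hy x Ox; apply: le_trans (hy x Ox).
  by rewrite lef_pV2 ?posrE// ler_nat.
apply/seteqP; split => [y Oy|y [n _ hy]]; last first.
  apply: contrapT => nOy; have := hy y nOy.
  by rewrite /= mdistxx leNgt invr_gt0 ltr0n.
have /nbhs_ballP[e /= e0 ball_O] : nbhs y O by exact: open_nbhs_nbhs.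
have [n ne] : exists n, n.+1%:R^-1 < e.
  exists (Num.truncn e^-1); rewrite invf_plt ?posrE//.
  exact: truncnS_gt.
exists n => // x nOx /=; rewrite leNgt; apply/negP => xy; apply: nOx.
by apply: ball_O; rewrite ballEmdist/= metric_sym (lt_trans xy).
Qed.

(** The sets that can be squeezed between a closed and an open set of nearby
    measures contain the open sets, which are increasing unions of closed
    sets, and form a sigma-algebra.  For a countable union one keeps finitely
    many of the inner closed sets, by continuity from above. *)
Lemma borel_regular mu A (e : R) : measurable A -> 0 < e ->
  exists C O : set X, [/\ closed C, open O, C `<=` A, A `<=` O &
    (mu (O `\` C : set (borelType X)) < e%:E)%E].
Proof.
move=> mA; move: e.
pose H := [set A : set X | forall e : R, 0 < e ->
  exists C O : set X, [/\ closed C, open O, C `<=` A, A `<=` O &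
    (mu (O `\` C : set (borelType X)) < e%:E)%E]].
suff : <<s @open X >> `<=` H by apply.
apply: smallest_sub; last first.
  move=> O oO e e0; have [C [cC ndC] OC] := open_closed_exhaustion oO.
  have [n|m n mn| |n ltn] :=
    @nonincreasing_measure_lt mu (fun n => O `\` C n) e%:E.
  - by apply: measurableD; [exact: borel_open|exact: borel_closed].
  - by apply/subsetPset; apply: setDS; apply/subsetPset; exact: ndC.
  - rewrite bigcupDr; last by exists 0.
    by rewrite -OC setDv measure0 lte_fin.
  - exists (C n), O; split => //; last by rewrite OC; exact: bigcup_sup.
split.
- move=> e e0; exists set0, set0; split => //; first exact: closed0.
    exact: open0.
  by rewrite setDv measure0 lte_fin.
- move=> B HB e e0; have [C [V [cC oV CB BV lt_e]]] := HB e e0.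
  exists (~` V), (~` C); split; first exact: open_closedC.
  + exact: closed_openC.
  + by rewrite setTD; exact: subsetC.
  + by rewrite setTD; exact: subsetC.
  + by rewrite setDE setCK setIC -setDE.
move=> B HB e e0.
(* The errors add up to [e / 2], which leaves room for truncating the union
   of the inner closed sets. *)
have /choice[CO COP] : forall n, exists CO : set X * set X,
    [/\ closed CO.1, open CO.2, CO.1 `<=` B n, B n `<=` CO.2 &
    (mu (CO.2 `\` CO.1 : set (borelType X)) < (e / 2 / (2 ^ n.+1)%:R)%:E)%E].
  move=> n; have [|C [V CV]] := HB n (e / 2 / (2 ^ n.+1)%:R).
    by rewrite !divr_gt0// ltr0n expn_gt0.
  by exists (C, V).
pose O := \bigcup_n (CO n).2; pose C n := \big[setU/set0]_(i < n) (CO i).1.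
have oO : open O by apply: bigcup_open => n _; have [] := COP n.
have cC n : closed (C n).
  by apply: closed_bigsetU => i _; have [] := COP i.
have mOC n : measurable ((CO n).2 `\` (CO n).1 : set (borelType X)).
  have [c o _ _ _] := COP n.
  by apply: measurableD; [exact: borel_open|exact: borel_closed].
have [n|m n mn| |n ltn] :=
  @nonincreasing_measure_lt mu (fun n => O `\` C n) e%:E.
- by apply: measurableD; [exact: borel_open|exact: borel_closed].
- apply/subsetPset; apply: setDS.
  exact: (@subset_bigsetU _ (fun i => (CO i).1) _ _ mn).
- apply: le_lt_trans (_ : ((e / 2)%:E < _)%E); last first.
    by rewrite lte_fin ltr_pdivrMr// ltr_pMr// ltr1n.
  have e20 : 0 <= e / 2 by rewrite divr_ge0// ltW.
  apply: (le_trans _ (epsilon_trick0 xpredT e20)).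
  apply: (le_trans (measure_sigma_subadditive mu mOC _ _)).
  + apply: bigcapT_measurable => n.
    by apply: measurableD; [exact: borel_open|exact: borel_closed].
  + rewrite bigcupDr; last by exists 0.
    move=> x [[n _ On] nC]; exists n => //; split=> // Cn; apply: nC.
    by exists n.+1 => //; rewrite /C big_ord_recr/=; right.
  + by apply: lee_nneseries => // n _; have [_ _ _ _ /ltW] := COP n.
exists (C n), O; split => //.
- rewrite /C -(bigcup_mkord n (fun i => (CO i).1)) => x [i _ Cx].
  by exists i => //; have [_ _ CB _ _] := COP i; exact: CB.
- by apply: subset_bigcup => i _; have [] := COP i.
Qed.

End Regularity.

(** * Slow growth of shadowing families forces zero entropy *)

Section Shadowing.
Context {R : realType} {X : pointedMetricType R}.

(** Up to [e], the orbit segments of length [n] that start in [K] are among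
    [C * expR (r * n)] sequences of points, which need not be orbits: [K] has
    topological entropy at most [r] at scale [e]. *)
Definition shadowed_at_rate (f : X -> X) (K : set X) (e r : R) :=
  exists C : R, forall n, exists (J : finType) (ref : J -> nat -> X),
    [/\ (0 < #|J|)%N, #|J|%:R <= C * expR (r * n%:R)
      & forall y, K y -> exists i, forall j, (j < n)%N ->
          mdist (iter j f y) (ref i j) <= e].

(** Shrinking the cells to closed sets [C i] costs little measure, and
    disjoint compact sets are at positive distance.  Hence [z] determines the
    cell of any nearby point outside the exceptional set [U]: a point has at
    most one core within half the gap. *)
Lemma compact_cores_of_partition (cptX : compact [set: X])
    (mu : probability (borelType X) R) k (P : 'I_k -> set (borelType X))
    (delta : R) :
  measurable_partition P -> 0 < delta ->
  exists (U : set (borelType X)) (g : R) (lab : X -> 'I_k),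
    [/\ measurable U, fine (mu U) <= delta, 0 < g &
      forall i y z, P i y -> ~ U y -> mdist y z <= g -> P (lab z) y].
Proof.
move=> partP delta0.
have [i0 _] := partition_coverE partP point.
have k0 : 0 < k%:R :> R.
  by rewrite ltr0n; exact: leq_ltn_trans (leq0n i0) (ltn_ord i0).
have /choice[C CP] : forall i, exists C : set X, [/\ closed C, C `<=` P i &
    (mu (P i `\` C : set (borelType X)) < (delta / k%:R)%:E)%E].
  move=> i; have [_ /(_ i) mPi] := partP.
  have [|C [V [cC oV CP PV lt_d]]] := borel_regular mu (e := delta / k%:R) mPi.
    by rewrite divr_gt0.
  exists C; split=> //; apply: le_lt_trans lt_d; rewrite le_measure ?inE//.
  - by apply: measurableD => //; exact: borel_closed.
  - by apply: measurableD; [exact: borel_open|exact: borel_closed].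
  - exact: setSD.
pose D i : set (borelType X) := P i `\` C i.
have mD i : measurable (D i).
  have [_ /(_ i) mPi] := partP; have [cC _ _] := CP i.
  by apply: measurableD => //; exact: borel_closed.
have near_gaps : \forall g \near (0 : R)^'+,
    forall ij : 'I_k * 'I_k, ij.1 != ij.2 ->
    forall x y, C ij.1 x -> C ij.2 y -> g < mdist x y.
  apply: filter_forall => -[i j] /=.
  have [->|ij] := eqVneq i j; first by near=> g.
  have [cCi CPi _] := CP i; have [cCj CPj _] := CP j.
  have := @disjoint_compact_gap _ _ (C i) (C j).
  have cptC (A : set X) : closed A -> compact A.
    by move=> cA; apply: subclosed_compact cA cptX _.
  move=> /(_ (cptC _ cCi) (cptC _ cCj)) near_gap.
  apply: filterS (near_gap _) => [g gP _|]; first exact: gP.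
  rewrite -subset0 => y [/CPi Piy /CPj Pjy].
  by move/eqP : ij; apply; exact: (partition_uniq partP Piy Pjy).
have [g [g0 gP]] := filter_ex (filterI (nbhs_right_gt (0 : R)) near_gaps).
have /choice[lab labP] : forall z, exists i, forall i' y,
    C i' y -> mdist y z <= g / 2 -> i' = i.
  move=> z; have [[i [y [Ciy yz]]]|no_i] :=
    pselect (exists i y, C i y /\ mdist y z <= g / 2).
    exists i => i' y' Ciy' y'z; apply/eqP; apply: contrapT => /negP neq.
    have := gP (i', i) neq y' y Ciy' Ciy; rewrite ltNge => /negP; apply.
    apply: le_trans (metric_triangle _ z _) _.
    by rewrite (splitr g) lerD// metric_sym.
  by exists i0 => i y Ciy yz; exfalso; apply: no_i; exists i, y.
exists (\bigcup_(i in [set: 'I_k]) D i), (g / 2), lab; split.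
- exact: fin_bigcup_measurable.
- have := @sum_measure_le _ _ _ mu 'I_1 'I_k
    (fun=> \bigcup_(i in [set: 'I_k]) D i) D (fun=> 1) (fun=> 1).
  rewrite big_ord1 mul1r => h; apply: le_trans (h _ _ _ _ _) _ => //.
  + by move=> _; exact: fin_bigcup_measurable.
  + move=> y; rewrite big_ord1 mul1r indicE; case: (boolP (y \in _)) => [|_].
      rewrite inE => -[i _ Diy].
      by rewrite (bigD1 i)//= mul1r indicE mem_set// lerDl sumr_ge0.
    by rewrite sumr_ge0.
  + apply: le_trans (_ : \sum_(i < k) delta / k%:R <= _).
      apply: ler_sum => i _; rewrite /= mul1r -lee_fin fineK ?fin_num_measure//.
      by have [_ _ /ltW] := CP i.
    rewrite sumr_const card_ord -[leLHS]mulr_natl mulrCA divff ?mulr1//.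
    by rewrite gt_eqF.
- by rewrite divr_gt0.
- move=> i y z Piy nUy yz.
  have Ciy : C i y by apply: contrapT => nCiy; apply: nUy; exists i.
  by rewrite -(labP z i y Ciy yz).
Unshelve. all: by end_near. Qed.

(** The reference segments give names, and the cost of corrections is made
    small in this order: the correction probability [c] is chosen so that a
    confirmation costs [e / 5], then [U] and the complement of [K] are taken of
    measure at most [delta] with [ln (k / c) * delta <= e / 5], and finally
    [n] is taken large. *)
Lemma entropy_eq0_of_shadowing (cptX : compact [set: X])
    (mu : probability (borelType X) R) (f : borelType X -> borelType X) :
  measurable_fun setT f ->
  (forall A, measurable A -> mu (f @^-1` A) = mu A) ->
  (forall e r delta : R, 0 < e -> 0 < r -> 0 < delta ->
    exists K : set (borelType X), [/\ measurable K,
      fine (mu (~` K)) <= delta & shadowed_at_rate f K e r]) ->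
  (measure_entropy mu f <= 0)%E.
Proof.
move=> mf invf shadow; apply: ge_ereal_sup => _ [k [P [partP ->]]].
rewrite lee_fin /partition_entropy.
set H := fun n => _; suff : H @ \oo --> (0 : R) by move/cvg_lim => ->.
apply/cvgrPdist_lt => e e0.
have H0 n : 0 <= H n.
  rewrite divr_ge0// oppr_ge0 sumr_le0// => w _.
  rewrite mulr_ge0_le0 ?fine_ge0// ln_le0// -lee_fin fineK ?fin_num_measure//.
    by apply: probability_le1; exact: (measurable_refined_cell mf partP).
  exact: (measurable_refined_cell mf partP).
pose e5 := e / 5; have e50 : 0 < e5 by rewrite divr_gt0.
(* A confirmed letter costs [- ln (1 - c) = e / 5]. *)
pose c := 1 - expR (- e5).
have c01 : 0 < c < 1.
  rewrite subr_gt0 ltrBlDr ltrDl expR_gt0 andbT -expR0 ltr_expR.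
  by rewrite oppr_lt0.
pose b := ln (k%:R / c).
have b0 : 0 <= b.
  have [i0 _] := partition_coverE partP point.
  move/andP: c01 => [c0 c1].
  rewrite ln_ge0// ler_pdivlMr// mul1r (le_trans (ltW c1))// ler1n.
  exact: leq_ltn_trans (leq0n i0) (ltn_ord i0).
pose delta := e5 / (b + 1).
have delta0 : 0 < delta by rewrite divr_gt0// ltr_wpDl.
have bdelta : b * delta <= e5.
  by rewrite mulrCA ler_piMr ?ltW// ltr_pdivrMr ?ltr_wpDl// mul1r ltrDl.
have [U [g [lab [mU Udelta g0 labP]]]] :=
  compact_cores_of_partition cptX mu partP delta0.
have [K [mK Kdelta [C shadowK]]] := shadow g e5 delta g0 e50 delta0.
have Hle n : (0 < n)%N -> H n <= ln C / n%:R + 4 * e5.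
  move=> n0; have n0R : 0 < n%:R :> R by rewrite ltr0n.
  have [J [ref [J0 J_le refP]]] := shadowK n.
  have J1 : 1 <= #|J|%:R :> R by rewrite ler1n.
  have C0 : 0 < C.
    by rewrite -(pmulr_lgt0 _ (expR_gt0 (e5 * n%:R))) (lt_le_trans _ J_le)//
       (lt_le_trans _ J1).
  have lnJ : ln #|J|%:R <= ln C + e5 * n%:R.
    rewrite -(expRK (e5 * n%:R)) -lnM ?posrE ?expR_gt0//.
    by rewrite ler_ln ?posrE ?mulr_gt0 ?expR_gt0 ?(lt_le_trans _ J1).
  have := @entropy_le_names _ _ _ mu f mf invf k P partP J n
    (fun i j => lab (ref i j)) U K c J0 c01 mU mK.
  have -> : - ln (1 - c) = e5 by rewrite opprB addrCA subrr addr0 expRK opprK.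
  rewrite -/b => le_names.
  have {}le_names := le_trans (le_names _) _.
  rewrite ler_pdivrMr// mulrDl divfK ?gt_eqF//; apply: le_names.
    move=> y Ky; have [i iP] := refP y Ky; exists i => j nUy.
    have [i' Piy] := partition_coverE partP (iter j f y).
    exact: labP Piy nUy (iP _ (ltn_ord j)).
  have : b * (fine (mu U) + fine (mu (~` K))) <= 2 * e5.
    apply: le_trans (_ : b * (delta + delta) <= _); last by lra.
    by rewrite ler_wpM2l// lerD.
  move: lnJ; nra.
near=> n.
rewrite sub0r normrN ger0_norm//.
have n0 : (0 < n)%N by near: n; exact: nbhs_infty_gt.
apply: le_lt_trans (Hle n n0) _.
have n0R : 0 < n%:R :> R by rewrite ltr0n.
have : ln C / n%:R < e5.
  rewrite ltr_pdivrMr// mulrC -ltr_pdivrMr//.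
  by near: n; exact: nbhs_infty_gtr.
rewrite /e5; lra.
Unshelve. all: by end_near. Qed.

End Shadowing.

(** * Clocks of orbits that follow each other in a flow without fixed points *)

Section FlowGeometry.
Context {R : realType} {X : pointedMetricType R} (cptX : compact [set: X]).
Context (phi : R -> X -> X) (flow_phi : continuous_flow phi).

Lemma flow0 x : phi 0 x = x.
Proof. by have [] := flow_phi. Qed.

Lemma flowD t s x : phi (t + s) x = phi s (phi t x).
Proof. by have [] := flow_phi. Qed.

Lemma flowK t x : phi (- t) (phi t x) = x.
Proof. by rewrite -flowD subrr flow0. Qed.

Lemma continuous_flow_map t : continuous (phi t).
Proof.
move=> x; have [/(_ (t, x)) c _ _] := flow_phi.
refine (@continuous2_cvg X R X X (nbhs x) _ (fun=> t) id phi t x c _ _).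
  exact: cvg_cst.
exact: cvg_id.
Qed.

Lemma iter_flow j x : iter j (phi 1) x = phi j%:R x.
Proof.
elim: j => [|j ih]; first by rewrite flow0.
by rewrite iterS ih -flowD -natr1.
Qed.

Lemma flow_period t x m : phi t x = x -> phi (t * m%:R) x = x.
Proof.
move=> tx; elim: m => [|m ih]; first by rewrite mulr0 flow0.
by rewrite -natr1 mulrDr mulr1 flowD ih.
Qed.

Lemma flow_near_id e : 0 < e ->
  exists2 h, 0 < h & forall t x, `|t| <= h -> mdist (phi t x) x <= e.
Proof.
move=> e0; have /compact_near_coveringP := cptX.
move=> /(_ R (nbhs (0 : R)) (fun t x => mdist (phi t x) x < e)) near_cov.
have /nbhs_ballP[h /= h0 hP] : \forall t \near (0 : R),
    [set: X] `<=` [set x | mdist (phi t x) x < e].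
  apply: near_cov => x _; have [/(_ (0, x)) c _ _] := flow_phi.
  have : mdist (phi p.1 p.2) p.2 @[p --> (0, x)] --> mdist (phi 0 x) x.
    by apply: cvg_mdist; [exact: c|exact: cvg_snd].
  rewrite flow0 mdistxx => /cvgrPdist_lt /(_ e e0) [[/= A B] [A0 Bx] AB].
  exists (B, A) => // -[y t] [/= By At].
  have := AB (t, y) (conj At By).
  by rewrite /= sub0r normrN ger0_norm ?mdist_ge0.
exists (h / 2) => [|t x th]; first by rewrite divr_gt0.
apply: ltW; apply: hP => //; rewrite /ball/= sub0r normrN.
by rewrite (le_lt_trans th)// ltr_pdivrMr// ltr_pMr// ltr1n.
Qed.

Lemma flow_equicontinuous L e : 0 < e ->
  exists2 d, 0 < d & forall b x y, 0 <= b <= L -> mdist x y <= d ->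
    mdist (phi b x) (phi b y) < e.
Proof.
move=> e0.
have := compact_setX (@segment_compact R 0 L) cptX => /compact_near_coveringP.
move=> /(_ R (at_right 0) (fun d p => forall y, mdist p.2 y <= d ->
  mdist (phi p.1 p.2) (phi p.1 y) < e)) near_cov.
have nearP : \forall d \near (0 : R)^'+, forall p : R * X,
    (`[0, L] `*` [set: X]) p -> forall y, mdist p.2 y <= d ->
    mdist (phi p.1 p.2) (phi p.1 y) < e.
  apply: near_cov => -[b x] _; have [/(_ (b, x)) c _ _] := flow_phi.
  have e20 : 0 < e / 2 by rewrite divr_gt0.
  have := metricType_numDomainType.cvgr_dist_lt c e20.
  move=> [[/= A B] [Ab /nbhs_ballP[h /= h0 hB]] AB].
  exists (A `*` ball x (h / 2), [set d | d < h / 2]) => /=.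
    split; last by apply: nbhs_right_lt; rewrite divr_gt0.
    exists (A, ball x (h / 2)) => //; split=> //=.
    by apply: nbhsx_ballx; rewrite divr_gt0.
  move=> [[b' x'] d] /= [[Ab' xx'] dh] y x'y.
  have Bx' : B x'.
    apply: hB; move: xx'; rewrite !ballEmdist/= => /lt_le_trans; apply.
    by rewrite ler_pdivrMr// ler_pMr// ler1n.
  have By : B y.
    apply: hB; move: xx'; rewrite !ballEmdist/= => xx'.
    apply: le_lt_trans (metric_triangle x x' y) _.
    by rewrite (splitr h) ltrD// (le_lt_trans x'y).
  have /= d1 := AB (b', x') (conj Ab' Bx').
  have /= d2 := AB (b', y) (conj Ab' By).
  apply: le_lt_trans (metric_triangle _ (phi b x) _) _.
  by rewrite (splitr e) ltrD// metric_sym.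
have [d [d0 dP]] := filter_ex (filterI (nbhs_right_gt (0 : R)) nearP).
exists d => // b x y bL xy; exact: (dP (b, x)).
Qed.

(** Otherwise there are points [q n] of periods [e / (n + 2)].  Every time [t]
    is within such a period of one of its multiples, so [phi t (q n)] is
    uniformly close to [q n] for large [n], and a cluster point of [q] is
    fixed. *)
Lemma small_aperiodic_time e : ~ (exists x, fixed_point phi x) -> 0 < e ->
  exists2 t, 0 < t < e & forall x, phi t x <> x.
Proof.
move=> nofix e0; apply: contrapT => no_t; apply: nofix.
have /choice[q qP] : forall n : nat, exists x, phi (e / n.+2%:R) x = x.
  move=> n; apply: contrapT => nx; apply: no_t; exists (e / n.+2%:R).
    rewrite divr_gt0//= ltr_pdivrMr// ltr_pMr// ltr1n//.
  by move=> x ex; apply: nx; exists x.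
have [p [_ clp]] : [set: X] `&` cluster (q @ \oo) !=set0.
  by apply: cptX; exact: filterT.
have pos t : 0 <= t -> phi t p = p.
  move=> t0; apply: mdist_positivity; apply/eqP; rewrite eq_le mdist_ge0 andbT.
  apply/ler_addgt0Pl => /= e1 e10; rewrite addr0.
  have [h h0 hP] := flow_near_id e10.
  have clC : closed [set x | mdist (phi t x) x <= e1].
    apply: closed_mdist_le; first exact: continuous_flow_map.
    by move=> x; exact: cvg_id.
  apply: (clC p) => B Bp; apply: clp => //.
  suff : \forall n \near \oo, mdist (phi t (q n)) (q n) <= e1 by [].
  near=> n.
  have hn : e / n.+2%:R <= h.
    rewrite ler_pdivrMr// -ler_pdivrMl// mulrC ltW//.
    apply: (@lt_trans _ _ n%:R); last by rewrite ltr_nat.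
    by near: n; exact: nbhs_infty_gtr.
  set a := e / n.+2%:R in hn *; have a0 : 0 < a by rewrite divr_gt0.
  pose m := Num.truncn (t / a).
  have -> : t = a * m%:R + (t - a * m%:R) by rewrite addrCA subrr addr0.
  rewrite flowD flow_period; last exact: qP.
  apply: hP; have [|lo hi] := andP (truncn_itv (x := t / a) _).
    by rewrite divr_ge0// ltW.
  rewrite ler_pdivlMr// in lo; rewrite ltr_pdivrMr// -natr1 in hi.
  rewrite -/m in lo hi *; rewrite ger0_norm; first by lra.
  by rewrite subr_ge0 mulrC.
exists p => t; have [t0|t0] := leP 0 t; first exact: pos.
by rewrite -{1}(pos (- t)) ?oppr_ge0 ?ltW// -flowD addNr flow0.
Unshelve. all: by end_near. Qed.

Lemma aperiodic_displacement t : (forall x, phi t x <> x) ->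
  exists2 c, 0 < c &
    forall x, c <= mdist (phi t x) x /\ c <= mdist (phi (- t) x) x.
Proof.
move=> aper.
have cont : continuous (fun x => mdist (phi t x) x).
  by move=> x; apply: cvg_mdist; [exact: continuous_flow_map|exact: cvg_id].
have [x0 _ x0P] : exists2 c, c \in [set: X] & forall y, y \in [set: X] ->
    mdist (phi t c) c <= mdist (phi t y) y.
  apply: compact_EVT_min => //; first by exists point.
  exact: continuous_subspaceT.
exists (mdist (phi t x0) x0); first by rewrite mdist_gt0; apply/eqP.
move=> x; split; first by apply: x0P; rewrite inE.
have := x0P (phi (- t) x); rewrite -flowD addNr flow0 (metric_sym x); apply.
by rewrite inE.
Qed.

(** The clock [u] reads time on the orbit of the reference point [p], while
    [z] moves at unit speed: the data to be coded is then the single function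
    [u]. *)
Definition follows (d : R) (p z : X) (u : R -> R) :=
  [/\ continuous u, u 0 = 0 &
      forall s, 0 <= s -> mdist (phi (u s) p) (phi s z) <= d].

(** Over a time [b <= L] both the orbit of [phi (u a) p] run at unit speed
    and the one run by the clock stay close to the orbit of [phi a z].  So the
    clock error [v] always satisfies that [phi (v b)] moves some point by less
    than [c].  As [phi t] and [phi (- t)] move every point by at least [c], the
    continuous function [v], which starts at 0, cannot reach [t] or [- t]. *)
Lemma follows_near_isometry L t : 0 < t -> (forall x, phi t x <> x) ->
  exists2 d, 0 < d & forall p z u, follows d p z u ->
    forall a b, 0 <= a -> 0 <= b <= L -> `|u (a + b) - u a - b| < t.
Proof.
move=> t0 aper; have [c c0 cP] := aperiodic_displacement aper.
have c20 : 0 < c / 2 by rewrite divr_gt0.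
have [d1 d10 d1P] := flow_equicontinuous L c20.
pose d := Num.min d1 (c / 2).
have d0 : 0 < d by rewrite lt_min d10.
exists d => // p z u [cu u0 uP] a b a0 /andP[b0 bL].
pose v s := u (a + s) - u a - s.
have displ s : 0 <= s <= L ->
    mdist (phi (v s) (phi (u a + s) p)) (phi (u a + s) p) < c.
  move=> /[dup] sL /andP[s0 _].
  apply: le_lt_trans (metric_triangle _ (phi (a + s) z) _) _.
  rewrite (splitr c); apply: ler_ltD.
    rewrite -flowD (_ : _ + v s = u (a + s)); last by rewrite /v; ring.
    by apply: le_trans (uP _ (addr_ge0 a0 s0)) _; rewrite /d ge_min lexx orbT.
  rewrite (flowD a) (flowD (u a)) metric_sym; apply: d1P => //.
  by apply: le_trans (uP _ a0) _; rewrite /d ge_min lexx.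
rewrite ltNge; apply/negP => vb.
have cv : {within `[0, b], continuous v}.
  apply: continuous_subspaceT => s; apply: cvgB; last exact: cvg_id.
  apply: cvgB; last exact: cvg_cst.
  apply: (@cvg_comp _ _ _ (fun s => a + s) u); last exact: cu.
  by apply: cvgD; [exact: cvg_cst|exact: cvg_id].
have v0 : v 0 = 0 by rewrite /v addr0 subrr subr0.
have [w [wt [s s0b vs]]] : exists w, (w = t \/ w = - t) /\
    exists2 s, s \in `[0, b] & v s = w.
  have [vb0|vb0] := leP 0 (v b).
    exists t; split; first by left.
    apply: IVT => //; rewrite v0 min_l// max_r// ltW//=.
    by rewrite -/(v b) ger0_norm in vb.
  exists (- t); split; first by right.
  apply: IVT => //; rewrite v0 (min_r (ltW vb0)) (max_l (ltW vb0)).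
  rewrite oppr_le0 (ltW t0) andbT.
  by rewrite -/(v b) ltr0_norm// in vb; rewrite lerNr.
have sL : 0 <= s <= L.
  by move: s0b; rewrite in_itv/= => /andP[-> /le_trans]; apply.
have := displ s sL; rewrite vs ltNge => /negP; apply.
by have [h1 h2] := cP (phi (u a + s) p); case: wt => ->.
Qed.

End FlowGeometry.

(** * Coding of clocks and growth rate of tubes *)

Section Coding.
Context {R : realType}.

(** A word in three letters is read as a walk with steps -1, 0, 1; the drift
    is its position after [j] steps. *)
Definition drift B (w : {ffun 'I_B -> 'I_3}) (j : nat) : R :=
  \sum_(i < B | (i < j)%N) ((w i)%:R - 1).

(** The walk follows the clock error [c j], in units of [t], at the ends of
    the blocks of length [L].  Consecutive errors differ by less than one
    unit, so their integer parts differ by at most 1.  Rounding and the error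
    inside a block contribute [t] each. *)
Lemma drift_coding (u : R -> R) (t : R) (L B : nat) :
  0 < t -> u 0 = 0 ->
  (forall a b, 0 <= a -> 0 <= b <= L%:R -> `|u (a + b) - u a - b| < t) ->
  exists w : {ffun 'I_B -> 'I_3}, forall s, 0 <= s < (B * L)%:R ->
    `|u s - (s + t * drift w (Num.truncn (s / L%:R)))| <= 2 * t.
Proof.
move=> t0 u0 uP.
pose c j := (u (j * L)%:R - (j * L)%:R) / t.
pose m j : int := Num.floor (c j).
have mP j : (m j)%:~R <= c j < (m j)%:~R + 1.
  by have := floor_itv (c j); rewrite intrD.
have c_step j : `|c j.+1 - c j| < 1.
  have := uP (j * L)%:R L%:R; rewrite ler0n lexx -natrD ler0n => /(_ isT isT).
  rewrite (_ : (j * L + L)%N = (j.+1 * L)%N); last by rewrite mulSn addnC.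
  move=> h; rewrite /c -mulrBl normrM (gtr0_norm (x := t^-1)) ?invr_gt0//.
  rewrite ltr_pdivrMr// mul1r; apply: le_lt_trans h.
  rewrite le_eqVlt; apply/orP; left; apply/eqP; congr `|_|.
  by rewrite mulSn natrD; ring.
have m_step j : exists i : 'I_3, i%:R - 1 = (m j.+1)%:~R - (m j)%:~R :> R.
  have := c_step j; rewrite ltr_norml => /andP[s1 s2].
  have /andP[a1 a2] := mP j; have /andP[b1 b2] := mP j.+1.
  have lo : -1 <= m j.+1 - m j.
    rewrite -ltzD1 addrC -(ltr_int R) !intrD intrN; lra.
  have hi : m j.+1 - m j <= 1.
    rewrite -ltzD1 -(ltr_int R) !intrD intrN; lra.
  have : 0 <= m j.+1 - m j + 1 by lia.
  case E : (m j.+1 - m j + 1) => [i|//] _.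
  have i3 : (i < 3)%N by lia.
  exists (Ordinal i3) => /=.
  have -> : i%:R = (m j.+1 - m j + 1)%:~R :> R by rewrite E.
  by rewrite !intrD intrN; ring.
have /choice[w wP] := m_step.
exists [ffun i : 'I_B => w i] => s /andP[s0 sB].
have L0 : (0 < L)%N.
  by case: L {uP c m mP c_step m_step w wP} sB => // ; rewrite muln0 ltNge s0.
have L0R : 0 < L%:R :> R by rewrite ltr0n.
set j := Num.truncn (s / L%:R).
have [|lo hi] := andP (truncn_itv (x := s / L%:R) _).
  by rewrite divr_ge0.
rewrite -/j in lo hi; rewrite ler_pdivlMr// in lo; rewrite ltr_pdivrMr// in hi.
have jB : (j < B)%N.
  by have := le_lt_trans lo sB; rewrite -natrM ltr_nat ltn_pmul2r.
have -> : drift [ffun i : 'I_B => w i] j = (m j)%:~R.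
  pose step i : R := (m i.+1)%:~R - (m i)%:~R.
  rewrite /drift (eq_bigr (fun i : 'I_B => step i)); last first.
    by move=> i _; rewrite ffunE wP.
  rewrite -(@big_ord_widen _ _ _ j B step) ?(ltnW jB)//.
  rewrite -(big_mkord xpredT step).
  rewrite (telescope_sumr (fun i => (m i)%:~R : R))//.
  by rewrite /m /c mul0n u0 subrr mul0r floor0 subr0.
have us := uP (j * L)%:R (s - (j * L)%:R).
rewrite ler0n addrCA subrr addr0 in us.
have {us} : `|u s - u (j * L)%:R - (s - (j * L)%:R)| < t.
  apply: us => //; rewrite subr_ge0 natrM lo/= lerBlDr.
  by apply: ltW; rewrite -natr1 mulrDl mul1r addrC in hi.
rewrite ltr_norml => /andP[h1 h2].
have /andP[k1 k2] := mP j.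
have e1 : c j * t = u (j * L)%:R - (j * L)%:R by rewrite /c divfK// gt_eqF.
have k1' : t * (m j)%:~R <= c j * t by rewrite mulrC ler_pM2r.
have k2' : c j * t < t * (m j)%:~R + t.
  by rewrite -[X in _ + X]mulr1 -mulrDr mulrC ltr_pM2l.
rewrite ler_norml; apply/andP; split; lra.
Qed.

End Coding.

Section Tube.
Context {R : realType} {X : pointedMetricType R} (cptX : compact [set: X]).
Context (phi : R -> X -> X) (flow_phi : continuous_flow phi).

Definition tube (a b : R) (A : set X) : set X :=
  [set phi t z | t in `[a, b] & z in A].

Lemma compact_tube a b A : compact A -> compact (tube a b A).
Proof.
move=> cptA; have [cont _ _] := flow_phi.
have -> : tube a b A = (fun p => phi p.1 p.2) @` (`[a, b] `*` A).
  apply/seteqP; split => [_ [t tab [z Az <-]]|_ [[t z] [/= tab Az] <-]].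
    by exists (t, z).
  by exists t => //; exists z.
apply: continuous_compact; last first.
  exact: compact_setX (@segment_compact _ _ _) cptA.
exact: continuous_subspaceT.
Qed.

(** Growth rates are computed on [A], while compactness, hence measurability,
    is available on the tube of [closure A]. *)
Lemma tube_closure a b A : tube a b (closure A) `<=` closure (tube a b A).
Proof.
move=> _ [t tab [z clz <-]] B Bz.
have [z' [Az' Bz']] := clz _ (continuous_flow_map flow_phi Bz).
by exists (phi t z'); split => //; exists t => //; exists z'.
Qed.

(** For each [n], the points shadowed by one of finitely many segments form a
    closed set. *)
Lemma shadowed_closure K e r : shadowed_at_rate (phi 1) K e r ->
  shadowed_at_rate (phi 1) (closure K) e r.
Proof.
move=> [C shadow]; exists C => n; have [J [ref [J0 J_le refP]]] := shadow n.
exists J, ref; split => // y clKy; apply: contrapT => no_i.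
pose D i := \bigcap_(j in [set j | (j < n)%N])
  [set z | mdist (iter j (phi 1) z) (ref i j) <= e].
have clD i : closed (D i).
  apply: closed_bigI => j _; apply: closed_mdist_le => z; last exact: cvg_cst.
  rewrite (_ : iter j (phi 1) = phi j%:R); first exact: continuous_flow_map.
  by apply/funext => x; exact: iter_flow.
have [z [Kz nz]] : K `&` [set z | forall i, ~ D i z] !=set0.
  apply: clKy; apply: filter_forall => i.
  apply: (@open_nbhs_nbhs _ y (~` D i)); split; first exact: closed_openC.
  by move=> Diy; apply: no_i; exists i.
by have [i iP] := refP z Kz; exact: (nz i).
Qed.

(** A point [phi a z] of the tube is described by its starting time [a],
    rounded to a multiple of [t], and by a word of one letter per block of
    length [L] for the clock of [z].  This leaves about [3 ^ (n / L)] choices,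
    and [L] is taken so large that [ln 3 / L <= r].  Rounding [a], following
    [p], and rounding the clock contribute [e / 3] each. *)
Lemma shadowed_tube e r : ~ (exists x, fixed_point phi x) -> 0 < e -> 0 < r ->
  exists2 d, 0 < d & forall p (M : nat),
    shadowed_at_rate (phi 1)
      (tube 0 M%:R [set z | exists u, follows phi d p z u]) e r.
Proof.
move=> nofix e0 r0.
have e30 : 0 < e / 3 by rewrite divr_gt0.
have [h h0 hP] := flow_near_id cptX flow_phi e30.
have h20 : 0 < h / 2 by rewrite divr_gt0.
have [t /andP[t0 th] aper] := small_aperiodic_time cptX flow_phi nofix h20.
have ln3 : 0 < ln 3%:R :> R by rewrite ln_gt0// ltr1n.
pose L := (Num.truncn (ln 3%:R / r)).+1.
have L0 : 0 < L%:R :> R by rewrite ltr0n.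
have L_ge : ln 3%:R / L%:R <= r.
  rewrite ler_pdivrMr// mulrC -ler_pdivrMr// ltW//.
  by rewrite /L truncnS_gt.
have [d0 d00 iso] := follows_near_isometry cptX flow_phi L%:R t0 aper.
pose d := Num.min d0 (e / 3).
exists d; first by rewrite lt_min d00.
(* [Q] multiples of [t] in the interval from 0 to [M], and [B] blocks that
   cover all times up to [n + M]. *)
move=> p M; pose Q := (Num.truncn (M%:R / t)).+1.
exists (Q%:R * expR (ln 3%:R * (M%:R / L%:R + 1))) => n.
pose B := ((n + M) %/ L).+1.
have nMB : (n + M < B * L)%N by rewrite -ltn_divLR.
exists ({ffun 'I_B -> 'I_3} * 'I_Q)%type.
exists (fun (wk : {ffun 'I_B -> 'I_3} * 'I_Q) j =>
  let s := j%:R + t * (wk.2 : nat)%:R in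
  phi (s + t * drift wk.1 (Num.truncn (s / L%:R))) p).
split.
- rewrite card_prod card_ffun !card_ord muln_gt0 expn_gt0//.
- rewrite card_prod card_ffun !card_ord natrM mulrC -mulrA ler_pM2l ?ltr0n//.
  rewrite -expRD natrX -(lnK (x := 3%:R)) ?posrE// -expRM_natl ler_expR.
  have hB : B%:R <= (n + M)%:R / L%:R + 1 :> R.
    rewrite -natr1 lerD2r ler_pdivlMr// -natrM ler_nat; exact: leq_divM.
  rewrite natrD in hB.
  have hr : ln 3%:R / L%:R * n%:R <= r * n%:R by rewrite ler_wpM2r.
  apply: le_trans (_ : ln 3%:R * ((n%:R + M%:R) / L%:R + 1) <= _).
    by rewrite mulrC ler_pM2l.
  rewrite [leLHS](_ : _ = ln 3%:R / L%:R * n%:R + ln 3%:R * (M%:R / L%:R + 1)).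
    by rewrite expRK [leRHS]addrC lerD2r.
  by ring.
move=> _ [a aM [z [u fu] <-]].
have [cu u0 uP] := fu.
have fu0 : follows phi d0 p z u.
  by split=> // s s0; apply: le_trans (uP s s0) _; rewrite /d ge_min lexx.
have [w wP] := drift_coding B t0 u0 (iso _ _ _ fu0).
move: aM; rewrite /= in_itv/= => /andP[a0 aM].
have [|lo hi] := andP (truncn_itv (x := a / t) _).
  by rewrite divr_ge0// ltW.
rewrite ler_pdivlMr// in lo; rewrite ltr_pdivrMr// -natr1 in hi.
set k := Num.truncn (a / t) in lo hi.
have kQ : (k < Q)%N.
  by rewrite ltnS; apply: le_truncn; rewrite ler_pM2r ?invr_gt0.
exists (w, Ordinal kQ) => j jn /=.
set s := j%:R + t * k%:R.
have s0 : 0 <= s by rewrite addr_ge0// mulr_ge0// ltW.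
have sBL : s < (B * L)%:R.
  apply: (@le_lt_trans _ _ (n + M)%:R); last by rewrite ltr_nat.
  rewrite natrD lerD// ?ler_nat ?(ltnW jn)//.
  by rewrite mulrC (le_trans lo).
rewrite iter_flow// -flowD//.
rewrite (_ : a + j%:R = s + (a - k%:R * t)); last by rewrite /s; ring.
rewrite flowD//.
apply: le_trans (metric_triangle _ (phi s z) _) _.
apply: le_trans (lerD (hP _ _ _) (metric_triangle _ (phi (u s) p) _)) _.
  by rewrite ger0_norm ?subr_ge0//; lra.
set v := s + t * _.
have h1 : mdist (phi s z) (phi (u s) p) <= e / 3.
  by rewrite metric_sym (le_trans (uP s s0))// /d ge_min lexx orbT.
have h2 : mdist (phi (u s) p) (phi v p) <= e / 3.
  rewrite (_ : u s = v + (u s - v)); last by ring.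
  rewrite flowD//; apply: hP; apply: le_trans (wP s _) _; first by rewrite s0.
  by rewrite mulrC -ler_pdivlMr// ltW.
lra.
Qed.

End Tube.

(** * Stable classes are negligible *)

Section StableClasses.
Context {R : realType} {X : pointedMetricType R} (cptX : compact [set: X]).
Context (phi : R -> X -> X) (flow_phi : continuous_flow phi).

(** The union of all translates of [A] by the flow, written with bounded time
    intervals so that it is sigma-compact when [A] is compact. *)
Definition orbit_tube (A : set X) : set X :=
  \bigcup_(n : nat) tube phi (- n%:R) n%:R A.

Lemma orbit_tubeP A y : orbit_tube A y <-> exists t z, A z /\ phi t z = y.
Proof.
split=> [[n _ [t _ [z Az tz]]]|[t [z [Az tz]]]]; first by exists t, z.
exists (Num.truncn `|t|).+1 => //; exists t; last by exists z.
by rewrite /= in_itv/= -ler_norml ltW// truncnS_gt.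
Qed.

Lemma orbit_tube_invariant A t : phi t @` orbit_tube A = orbit_tube A.
Proof.
apply/seteqP; split => [_ [y /orbit_tubeP[s [z [Az <-]]] <-]|y].
  by apply/orbit_tubeP; exists (s + t), z; split => //; rewrite flowD.
move=> /orbit_tubeP[s [z [Az <-]]]; exists (phi (s - t) z).
  by apply/orbit_tubeP; exists (s - t), z.
by rewrite -flowD// subrK.
Qed.

(** Once the clock [k] (the inverse of the reparametrisation [h]) runs late
    enough for the orbits to be [d]-close, it passes through times [s0] with
    [t0 + s0] an integer [m].  Restarting there makes the reference point one
    of the countably many [phi m x], with clock starting at 0. *)
Lemma Ws_follows x d : 0 < d ->
  Ws phi x `<=` \bigcup_(m : nat)
    orbit_tube [set z | exists u, follows phi d (phi m%:R x) z u].
Proof.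
move=> d0 y [t0 _ [h [h_incr h0 ch [k [hk kh ck]]] /cvgrPdist_lt /(_ d d0)]].
move=> [S [_ SP]].
pose m := (Num.truncn (S + t0)).+1; pose s0 := m%:R - t0.
have Ss0 : S < s0.
  by rewrite ltrBrDr truncnS_gt.
have k_mono : {homo k : a b / a <= b}.
  move=> a b ab; rewrite leNgt; apply/negP => /h_incr.
  by rewrite !kh ltNge ab.
exists m => //; apply/orbit_tubeP; exists (- h s0), (phi (h s0) y).
split; last exact: flowK.
exists (fun r => k (h s0 + r) - s0); split.
- move=> r; apply: cvgB; last exact: cvg_cst.
  apply: (@cvg_comp _ _ _ (fun r => h s0 + r) k); last exact: ck.
  by apply: cvgD; [exact: cvg_cst|exact: cvg_id].
- by rewrite addr0 hk subrr.
move=> r r0; pose s := k (h s0 + r).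
have ss0 : s0 <= s by rewrite -[s0]hk k_mono// lerDl.
rewrite -!flowD//.
have -> : m%:R + (k (h s0 + r) - s0) = t0 + s by rewrite /s /s0; ring.
have -> : h s0 + r = h s by rewrite /s kh.
rewrite flowD//; apply: ltW.
have := SP s (lt_le_trans Ss0 ss0).
by rewrite /= sub0r normrN ger0_norm ?mdist_ge0.
Qed.

Lemma measurable_flow_map t :
  measurable_fun setT (phi t : borelType X -> borelType X).
Proof.
refine (@measurability _ _ (borelType X) (borelType X) setT (phi t)
  (@open X) erefl _).
move=> _ [B oB <-]; rewrite setTI; apply: borel_open.
by apply: open_comp => // x _; exact: continuous_flow_map.
Qed.

(** Otherwise the saturation has measure 1, and so has, nearly, one of its
    compact tubes over [- n, n].  Its translate by [phi n] is a tube over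
    nonnegative times, of the same measure, which contradicts the lower bound
    on the measure missed by sets of growth rate [r]. *)
Lemma orbit_tube_null (mu : probability (borelType X) R) (A : set X)
    (e r delta : R) :
  flow_ergodic phi mu -> 0 < delta ->
  (forall K : set (borelType X), measurable K ->
     shadowed_at_rate (phi 1) K e r -> delta < fine (mu (~` K))) ->
  (forall M : nat, shadowed_at_rate (phi 1) (tube phi 0 M%:R A) e r) ->
  measurable (orbit_tube (closure A) : set (borelType X)) /\
  mu (orbit_tube (closure A)) = 0.
Proof.
move=> [inv erg] delta0 big shadow.
have cptA : compact (closure A).
  exact: subclosed_compact (@closed_closure _ A) cptX _.
have mtube a b : measurable (tube phi a b (closure A) : set (borelType X)).
  apply: borel_closed; apply: compact_closed; first exact: metric_hausdorff.
  exact: compact_tube.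
have mO : measurable (orbit_tube (closure A) : set (borelType X)).
  by apply: bigcup_measurable => n _; exact: mtube.
split => //; apply: contrapT => /eqP O_neq0.
have := erg _ mO (orbit_tube_invariant (closure A)) => /eqP.
rewrite mule_eq0 (negPf O_neq0)/= => /eqP OC0.
have [n|a b ab| |n ltn] := @nonincreasing_measure_lt _ _ mu
  (fun n => ~` tube phi (- n%:R) n%:R (closure A)) delta%:E.
- exact: measurableC.
- apply/subsetPset; apply: subsetC => _ [t tI [z Az <-]].
  exists t; last by exists z.
  move: tI; rewrite /= !in_itv/= -!ler_norml => /le_trans; apply.
  by rewrite ler_nat.
- by rewrite -setC_bigcup OC0 lte_fin.
have shift : tube phi (- n%:R) n%:R (closure A) =
    phi n%:R @^-1` tube phi 0 (n + n)%:R (closure A).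
  apply/seteqP; split => [_ [t tI [z Az <-]]|y [t tI [z Az ty]]].
    exists (t + n%:R); last by exists z; rewrite // flowD.
    move: tI; rewrite /= !in_itv/= natrD => /andP[? ?].
    by apply/andP; split; lra.
  exists (t - n%:R); last by exists z; rewrite // flowD// ty flowK.
  move: tI; rewrite /= !in_itv/= natrD => /andP[? ?].
  by apply/andP; split; lra.
move: ltn; rewrite shift preimage_setC inv; last exact: measurableC.
apply/negP; rewrite -leNgt -[leRHS]fineK ?fin_num_measure//; last first.
  exact: measurableC.
rewrite lee_fin ltW//; apply: big => //.
have [C CP] := shadowed_closure flow_phi (shadow (n + n)%N).
exists C => N; have [J [ref [J0 J_le refP]]] := CP N.
by exists J, ref; split => // y /(tube_closure flow_phi) /refP.
Qed.

(** Positive entropy provides a scale [e], a rate [r] and a mass [delta] such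
    that every set of rate [r] at scale [e] misses mass [delta]; at that scale
    the countably many saturated sets that cover the stable class are all
    null. *)
Lemma Ws_negligible (mu : probability (borelType X) R) x :
  ~ (exists x, fixed_point phi x) ->
  flow_ergodic phi mu -> (0 < flow_entropy phi mu)%E ->
  mu.-negligible (Ws phi x).
Proof.
move=> nofix erg; have [inv _] := erg => pos.
have [e [r [delta [e0 r0 delta0 big]]]] : exists e r delta : R,
    [/\ 0 < e, 0 < r, 0 < delta & forall K : set (borelType X), measurable K ->
      shadowed_at_rate (phi 1) K e r -> delta < fine (mu (~` K))].
  apply: contrapT => none; move: pos; apply/negP; rewrite -leNgt.
  apply: entropy_eq0_of_shadowing => //; first exact: measurable_flow_map.
    by move=> A mA; exact: inv.
  move=> e r delta e0 r0 delta0; apply: contrapT => noK; apply: none.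
  exists e, r, delta; split => // K mK shK; rewrite ltNge; apply/negP => leK.
  by apply: noK; exists K.
have [d d0 shadow] := shadowed_tube cptX flow_phi nofix e0 r0.
refine (@negligibleS _ _ _ mu _ (Ws phi x) (@Ws_follows x d d0) _).
apply: negligible_bigcup => m.
set A := (X in orbit_tube X).
have [mO O0] := orbit_tube_null erg delta0 big (shadow (phi m%:R x)).
exists (orbit_tube (closure A)); split => //.
move=> y /orbit_tubeP[t [z [Az <-]]]; apply/orbit_tubeP; exists t, z.
by split => //; exact: subset_closure.
Qed.

Lemma Ws_refl x : Ws phi x x.
Proof.
have cont_id : continuous (id : R -> R) by move=> s; exact: cvg_id.
exists 0 => //; exists id; first by split => //; exists id; split.
rewrite flow0//.
under eq_fun do rewrite mdistxx.
exact: cvg_cst.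
Qed.

End StableClasses.

Theorem theorem4 (R : realType) (X : pointedMetricType R)
    (cptX : compact [set: X]) (phi : R -> X -> X)
    (flow_phi : continuous_flow phi)
    (nofix : ~ exists x, fixed_point phi x) :
  (forall mu : probability (borelType X) R,
     flow_ergodic phi mu -> (0 < flow_entropy phi mu)%E ->
     forall A : set X, stable_class phi A -> mu.-null_set A)
  /\
  ((exists mu : probability (borelType X) R,
      flow_ergodic phi mu /\ (0 < flow_entropy phi mu)%E) ->
   ~ countable [set A : set X | stable_class phi A]).
Proof.
split=> [mu erg pos A [x ->]|[mu [erg pos]]].
  by apply: negligible_null_set; exact: Ws_negligible.
move=> /countable_injP[f injf].
pose F n : set (borelType X) :=
  [set y | exists A : set X, [/\ stable_class phi A, f A = n & A y]].
have negF n : mu.-negligible (F n).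
  have [[A [stA fA]]|noA] :=
    pselect (exists A : set X, stable_class phi A /\ f A = n).
    apply: negligibleS (_ : F n `<=` A) _ => [y [A' [stA' fA' A'y]]|].
      by rewrite (injf A A') ?inE// fA fA'.
    by have [x ->] := stA; exact: Ws_negligible.
  apply: negligibleS (_ : F n `<=` set0) _; last exact: negligible_set0.
  by move=> y [A [stA fA _]]; apply: noA; exists A.
have : mu.-negligible (\bigcup_n F n) by exact: negligible_bigcup.
have -> : \bigcup_n F n = setT.
  apply/seteqP; split => // y _; exists (f (Ws phi y)) => //.
  by exists (Ws phi y); split => //; [exists y|exact: Ws_refl].
move/(negligibleP mu measurableT) => mu0.
have : mu setT = 0%E by exact: mu0.
by move/eqP; rewrite probability_setT onee_eq0.
Qed.
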